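(* For every fixed $c\in(0,1)$, \[ \Pr\bigl[L_n\le c\ln n\bigr]=\exp\bigl(-(K(c)+o(1))\ln n\bigr)\qquad(n\to\infty), \] where $K(c)=\dfrac{(1-c)^2}{8c}$.
   Context: Let $\xi_1,\xi_2,\dots$ be i.i.d. random variables with $\Pr[\xi_i=1]=\Pr[\xi_i=-1]=1/2$, and let $S_t=\sum_{i=1}^t\xi_i$ (simple symmetric random walk, $S_0=0$). Define $L_n=\sum_{i=1}^n S_i^2/i^2$. *)

(* Defs.v *)
From Stdlib Require Import Reals Lra List.
Import ListNotations.
Open Scope R_scope.

(* All sign sequences (xi_1,...,xi_n) in {+1,-1}^n, encoded as bool lists
   (true = +1, false = -1); each has probability 2^{-n}. *)
Fixpoint all_seqs (n : nat) : list (list bool) :=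
  match n with
  | O => [ [] ]
  | S m => map (cons true) (all_seqs m) ++ map (cons false) (all_seqs m)
  end.

Definition xi (b : bool) : R := if b then 1 else -1.

Definition Swalk (t : nat) (xs : list bool) : R :=
  fold_right Rplus 0 (map xi (firstn t xs)).

Fixpoint rsum (f : nat -> R) (n : nat) : R :=
  match n with
  | O => 0
  | S m => rsum f m + f (S m)
  end.

Definition Ln (xs : list bool) : R :=
  rsum (fun i => (Swalk i xs) ^ 2 / (INR i) ^ 2) (length xs).

Definition probL (c : R) (n : nat) : R :=
  INR (length (filter (fun xs => if Rle_dec (Ln xs) (c * ln (INR n)) then true else false)
                      (all_seqs n))) / 2 ^ n.

Definition Kc (c : R) : R := (1 - c) ^ 2 / (8 * c).

(* Main.v *)
(* Let W(k,x) = E[exp(-lam sum_{k<i<=n} S_i^2/i^2) | S_k = x], computed by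
   backward recursion in k. One step maps exp(-b x^2) to
   exp(-b - b x^2) cosh(2 b x), and cosh y is close to exp(y^2/2) for small y, so
   Gaussian profiles exp(-G_k - b_k x^2) are sub- and supersolutions as soon as
   b_k satisfies a discrete Riccati inequality. With b_k ~ a/k the threshold is
   a + 2 a^2 = lam, whence E exp(-lam L_n) = n^(-a+o(1)). Chernoff's bound with
   a = (1/c - 1)/4 gives the upper estimate, and the tilting argument of
   Gartner-Ellis, comparing the transform at three nearby values of lam, gives
   the lower one. *)
Require Import Defs.
From Stdlib Require Import Reals Lra Lia List.
From Coquelicot Require Import Coquelicot.
Import ListNotations.
Open Scope R_scope.

(** * Comparison of cosh with Gaussian functions *)

(** The hyperbolic inequalities below follow by integrating a nonnegative derivative from 0, each
    feeding the next; evenness then covers negative arguments. *)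
Lemma nonneg_derive_ge (f f' : R -> R) (y : R) :
  (forall x, is_derive f x (f' x)) -> (forall x, 0 <= x -> 0 <= f' x) ->
  0 <= y -> f 0 <= f y.
Proof.
  intros Hd Hp Hy.
  destruct (MVT_gen f 0 y f') as [z [Hz Heq]].
  - intros x _; apply Hd.
  - intros x _; apply continuity_pt_filterlim, @ex_derive_continuous.
    now exists (f' x).
  - rewrite Rmin_left, Rmax_right in Hz by lra.
    assert (0 <= f' z * (y - 0)) by (apply Rmult_le_pos; [apply Hp|]; lra).
    lra.
Qed.

Lemma exp_plus_opp_ge2 (y : R) : 2 <= exp y + exp (- y).
Proof.
  assert (H1 := exp_ineq1_le y). assert (H2 := exp_ineq1_le (- y)). lra.
Qed.

Lemma exp_minus_opp_ge (y : R) : 0 <= y -> 2 * y <= exp y - exp (- y).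
Proof.
  intros Hy.
  assert (H := nonneg_derive_ge (fun t => exp t - exp (- t) - 2 * t)
                 (fun t => exp t + exp (- t) - 2) y).
  cbv beta in H. rewrite Ropp_0, exp_0 in H.
  enough (1 - 1 - 2 * 0 <= exp y - exp (- y) - 2 * y) by lra.
  apply H; auto.
  - intros x; auto_derive; [auto | ring].
  - intros x _. assert (H1 := exp_plus_opp_ge2 x). lra.
Qed.

Lemma even_nonneg (P : R -> Prop) :
  (forall y, 0 <= y -> P y) -> (forall y, P (- y) -> P y) -> forall y, P y.
Proof.
  intros H0 Hs y. destruct (Rle_dec 0 y); [auto|].
  apply Hs, H0; lra.
Qed.

Lemma exp_plus_opp_ge_quadratic (y : R) : 2 + y ^ 2 <= exp y + exp (- y).
Proof.
  revert y; apply even_nonneg.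
  - intros y Hy.
    assert (H := nonneg_derive_ge (fun t => exp t + exp (- t) - t ^ 2)
                   (fun t => exp t - exp (- t) - 2 * t) y).
    cbv beta in H. rewrite Ropp_0, exp_0 in H.
    enough (1 + 1 - 0 ^ 2 <= exp y + exp (- y) - y ^ 2) by lra.
    apply H; auto.
    + intros x; auto_derive; [auto | ring].
    + intros x Hx. assert (H1 := exp_minus_opp_ge x Hx). lra.
  - intros y H. rewrite Ropp_involutive in H. nra.
Qed.

Lemma sinh_le_mul_cosh (y : R) :
  0 <= y -> exp y - exp (- y) <= y * (exp y + exp (- y)).
Proof.
  intros Hy.
  assert (H := nonneg_derive_ge
                 (fun t => t * (exp t + exp (- t)) - (exp t - exp (- t)))
                 (fun t => t * (exp t - exp (- t))) y).
  cbv beta in H. rewrite Ropp_0, exp_0 in H.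
  enough (0 * (1 + 1) - (1 - 1) <=
          y * (exp y + exp (- y)) - (exp y - exp (- y))) by lra.
  apply H; auto.
  - intros x; auto_derive; [auto | ring].
  - intros x Hx. assert (H1 := exp_minus_opp_ge x Hx). nra.
Qed.

(** The product of cosh t and exp(-t^2/2) decreases on t >= 0, because sinh t <= t cosh t. *)
Lemma cosh_le_gauss (y : R) : (exp y + exp (- y)) / 2 <= exp (y ^ 2 / 2).
Proof.
  revert y; apply even_nonneg.
  - intros y Hy.
    assert (H := nonneg_derive_ge
                   (fun t => - ((exp t + exp (- t)) * exp (- (t ^ 2 / 2))))
                   (fun t => (t * (exp t + exp (- t)) - (exp t - exp (- t)))
                             * exp (- (t ^ 2 / 2))) y).
    cbv beta in H.
    replace (- (0 ^ 2 / 2)) with 0 in H by field.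
    rewrite Ropp_0, exp_0 in H.
    assert (H1 : (exp y + exp (- y)) * exp (- (y ^ 2 / 2)) <= 2).
    { enough (- ((1 + 1) * 1) <= - ((exp y + exp (- y)) * exp (- (y ^ 2 / 2))))
        by lra.
      apply H; auto.
      - intros x; auto_derive; [auto |].
        replace (x * (x * 1) * / 2) with (x ^ 2 / 2) by field. field.
      - intros x Hx. apply Rmult_le_pos; [|apply Rlt_le, exp_pos].
        assert (H1 := sinh_le_mul_cosh x Hx). lra. }
    rewrite (exp_Ropp (y ^ 2 / 2)) in H1.
    assert (Hp := exp_pos (y ^ 2 / 2)).
    apply (Rmult_le_compat_r (exp (y ^ 2 / 2))) in H1; [|lra].
    rewrite Rmult_assoc, Rinv_l in H1; lra.
  - intros y H. rewrite Ropp_involutive in H.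
    replace ((- y) ^ 2) with (y ^ 2) in H by ring. lra.
Qed.

(** With w = y^2/2, cosh y >= 1 + w and exp(rho w) <= 1/(1 - rho w). The condition rho w <= 1 - rho
    is what makes (1 + w)(1 - rho w) >= 1. *)
Lemma cosh_ge_gauss (rho y : R) :
  0 < rho -> rho * (y ^ 2 / 2) <= 1 - rho ->
  exp (rho * (y ^ 2 / 2)) <= (exp y + exp (- y)) / 2.
Proof.
  intros Hr Hy.
  assert (H1 := exp_plus_opp_ge_quadratic y).
  set (w := y ^ 2 / 2) in *.
  assert (Hw : 0 <= w) by (unfold w; nra).
  assert (H2 := exp_ineq1_le (- (rho * w))). rewrite exp_Ropp in H2.
  assert (Hp := exp_pos (rho * w)).
  assert (H3 : (1 - rho * w) * exp (rho * w) <= 1).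
  { apply (Rmult_le_compat_r (exp (rho * w))) in H2; [|lra].
    rewrite Rinv_l in H2; lra. }
  assert (H4 : 1 <= (1 + w) * (1 - rho * w)) by nra.
  assert (H5 : exp (rho * w) <= 1 + w).
  { assert (exp (rho * w) * 1 <= exp (rho * w) * ((1 + w) * (1 - rho * w)))
      by (apply Rmult_le_compat_l; lra).
    assert ((1 + w) * ((1 - rho * w) * exp (rho * w)) <= (1 + w) * 1)
      by (apply Rmult_le_compat_l; lra).
    lra. }
  unfold w in *; lra.
Qed.

(** * Expectation over uniform sign sequences *)

(** Recursion on the first sign makes conditioning on the first step of the walk a matter of
    computation; [Ex_indicator] links it to counting in [all_seqs]. *)
Fixpoint Ex (n : nat) (F : list bool -> R) : R :=
  match n with
  | O => F []
  | S m => (Ex m (fun xs => F (true :: xs)) + Ex m (fun xs => F (false :: xs))) / 2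
  end.

Lemma Ex_le (n : nat) (F G : list bool -> R) :
  (forall xs, length xs = n -> F xs <= G xs) -> Ex n F <= Ex n G.
Proof.
  revert F G; induction n as [|n IH]; intros F G H; simpl; [now apply H|].
  assert (Ex n (fun xs => F (true :: xs)) <= Ex n (fun xs => G (true :: xs)))
    by (apply IH; intros xs Hx; apply H; simpl; lia).
  assert (Ex n (fun xs => F (false :: xs)) <= Ex n (fun xs => G (false :: xs)))
    by (apply IH; intros xs Hx; apply H; simpl; lia).
  lra.
Qed.

Lemma Ex_ext (n : nat) (F G : list bool -> R) :
  (forall xs, length xs = n -> F xs = G xs) -> Ex n F = Ex n G.
Proof.
  intros H; apply Rle_antisym; apply Ex_le; intros xs Hx; rewrite (H xs Hx); lra.
Qed.

Lemma Ex_scal (n : nat) (a : R) (F : list bool -> R) :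
  Ex n (fun xs => a * F xs) = a * Ex n F.
Proof.
  revert F; induction n as [|n IH]; intros F; simpl; [reflexivity|].
  rewrite !(IH (fun xs => F (_ :: xs))). field.
Qed.

Lemma Ex_plus (n : nat) (F G : list bool -> R) :
  Ex n (fun xs => F xs + G xs) = Ex n F + Ex n G.
Proof.
  revert F G; induction n as [|n IH]; intros F G; simpl; [reflexivity|].
  rewrite !(IH (fun xs => F (_ :: xs))). field.
Qed.

Lemma Ex_const (n : nat) (a : R) : Ex n (fun _ => a) = a.
Proof. induction n as [|n IH]; simpl; [reflexivity|]. rewrite IH; field. Qed.

Lemma length_filter_map {A B : Type} (f : A -> B) (p : B -> bool) (l : list A) :
  length (filter p (map f l)) = length (filter (fun x => p (f x)) l).
Proof.
  induction l as [|x l IH]; simpl; [reflexivity|].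
  destruct (p (f x)); simpl; congruence.
Qed.

Lemma Ex_indicator (n : nat) (p : list bool -> bool) :
  INR (length (filter p (all_seqs n))) / 2 ^ n =
  Ex n (fun xs => if p xs then 1 else 0).
Proof.
  revert p; induction n as [|n IH]; intros p.
  - simpl. destruct (p []); simpl; field.
  - simpl all_seqs. rewrite filter_app, length_app, plus_INR, !length_filter_map.
    simpl Ex. rewrite <- !(IH (fun xs => p (_ :: xs))). simpl pow.
    field. apply pow_nonzero; lra.
Qed.

(** * The functional restarted at time k, and its Laplace transform *)

(** The share of L_n collected after time k by a walk located at x at time k. The first remaining
    sign is the step to time k + 1, hence [S k] in the denominator. *)
Fixpoint Lfrom (k : nat) (x : R) (xs : list bool) : R :=
  match xs with
  | [] => 0
  | b :: ys => (x + xi b) ^ 2 / INR (S k) ^ 2 + Lfrom (S k) (x + xi b) ys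
  end.

Lemma rsum_ext (f g : nat -> R) (n : nat) :
  (forall i, f i = g i) -> rsum f n = rsum g n.
Proof. intros H; induction n as [|n IH]; simpl; [auto|]. now rewrite IH, H. Qed.

Lemma rsum_recl (f : nat -> R) (n : nat) :
  rsum f (S n) = f 1%nat + rsum (fun i => f (S i)) n.
Proof.
  induction n as [|n IH]; [simpl; ring|].
  change (rsum f (S (S n))) with (rsum f (S n) + f (S (S n))).
  rewrite IH. simpl. ring.
Qed.

Lemma LfromE (k : nat) (x : R) (xs : list bool) :
  Lfrom k x xs =
  rsum (fun i => (x + Swalk i xs) ^ 2 / INR (k + i) ^ 2) (length xs).
Proof.
  revert k x; induction xs as [|b xs IH]; intros k x; [reflexivity|].
  simpl length. rewrite rsum_recl. simpl Lfrom. rewrite IH.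
  f_equal.
  - unfold Swalk. simpl firstn. simpl map. simpl fold_right.
    rewrite Nat.add_1_r. now rewrite Rplus_0_r.
  - apply rsum_ext; intros i.
    rewrite Nat.add_succ_r, Nat.add_succ_l.
    unfold Swalk. simpl firstn. simpl map. simpl fold_right.
    now rewrite Rplus_assoc.
Qed.

Lemma Ln_Lfrom (xs : list bool) : Ln xs = Lfrom 0 0 xs.
Proof.
  rewrite LfromE. apply rsum_ext; intros i. now rewrite Rplus_0_l.
Qed.

(** Here m counts the remaining steps, so the horizon is n = k + m, and induction on m is backward
    induction in time. *)
Definition W (lam : R) (m k : nat) (x : R) : R :=
  Ex m (fun xs => exp (- (lam * Lfrom k x xs))).

Lemma W_0 (lam : R) (k : nat) (x : R) : W lam 0 k x = 1.
Proof. unfold W; simpl. rewrite Rmult_0_r, Ropp_0. apply exp_0. Qed.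

Lemma W_S (lam : R) (m k : nat) (x : R) :
  W lam (S m) k x =
  (exp (- (lam / INR (S k) ^ 2 * (x + 1) ^ 2)) * W lam m (S k) (x + 1) +
   exp (- (lam / INR (S k) ^ 2 * (x - 1) ^ 2)) * W lam m (S k) (x - 1)) / 2.
Proof.
  replace (x - 1) with (x + -1) by ring.
  unfold W; cbn [Ex]. rewrite <- !Ex_scal.
  f_equal; f_equal; apply Ex_ext; intros xs _; rewrite <- exp_plus; f_equal;
    cbn [Lfrom xi]; unfold Rdiv; ring.
Qed.

Lemma W_nonneg (lam : R) (m k : nat) (x : R) : 0 <= W lam m k x.
Proof.
  unfold W. rewrite <- (Ex_const m 0). apply Ex_le; intros; apply Rlt_le, exp_pos.
Qed.

Lemma exp_le (x y : R) : x <= y -> exp x <= exp y.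
Proof. intros [H| ->]; [apply Rlt_le, exp_increasing; auto | lra]. Qed.

Lemma exp_opp_le_1 (x : R) : 0 <= x -> exp (- x) <= 1.
Proof. intros H. rewrite <- exp_0. apply exp_le; lra. Qed.

(** * One step on Gaussian profiles, and increments of the logarithm *)

Lemma gauss_step (b x : R) :
  (exp (- (b * (x + 1) ^ 2)) + exp (- (b * (x - 1) ^ 2))) / 2 =
  exp (- b - b * x ^ 2) * ((exp (2 * b * x) + exp (- (2 * b * x))) / 2).
Proof.
  replace (- (b * (x + 1) ^ 2)) with (- b - b * x ^ 2 + - (2 * b * x)) by ring.
  replace (- (b * (x - 1) ^ 2)) with (- b - b * x ^ 2 + 2 * b * x) by ring.
  rewrite !exp_plus. field.
Qed.

(** Replacing cosh(2bx) by exp((2bx)^2/2) gives a Gaussian again, with the Riccati map b -> b - 2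
    b^2 acting on its coefficient. *)
Lemma gauss_step_le (b x : R) :
  (exp (- (b * (x + 1) ^ 2)) + exp (- (b * (x - 1) ^ 2))) / 2 <=
  exp (- b - (b - 2 * b ^ 2) * x ^ 2).
Proof.
  rewrite gauss_step.
  replace (- b - (b - 2 * b ^ 2) * x ^ 2)
    with (- b - b * x ^ 2 + (2 * b * x) ^ 2 / 2) by field.
  rewrite exp_plus. apply Rmult_le_compat_l; [apply Rlt_le, exp_pos|].
  apply cosh_le_gauss.
Qed.

Lemma gauss_step_ge (rho b x : R) :
  0 < rho -> rho * (2 * b ^ 2 * x ^ 2) <= 1 - rho ->
  exp (- b - (b - 2 * rho * b ^ 2) * x ^ 2) <=
  (exp (- (b * (x + 1) ^ 2)) + exp (- (b * (x - 1) ^ 2))) / 2.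
Proof.
  intros Hr Hx. rewrite gauss_step.
  replace (- b - (b - 2 * rho * b ^ 2) * x ^ 2)
    with (- b - b * x ^ 2 + rho * ((2 * b * x) ^ 2 / 2)) by field.
  rewrite exp_plus. apply Rmult_le_compat_l; [apply Rlt_le, exp_pos|].
  apply cosh_ge_gauss; [auto|].
  replace ((2 * b * x) ^ 2 / 2) with (2 * b ^ 2 * x ^ 2) by field. auto.
Qed.

(** This bound and the next turn the sum of the increments a/k of G_k into a telescoping sum of
    logarithms. *)
Lemma ln_step_ub (t : R) : 0 < t -> ln (t + 1) - ln t <= / t.
Proof.
  intros Ht. rewrite <- ln_div by lra.
  replace ((t + 1) / t) with (1 + / t) by (field; lra).
  assert (0 < / t) by (apply Rinv_0_lt_compat; lra).
  rewrite <- (ln_exp (/ t)) at 2. apply ln_le; [lra|]. apply exp_ineq1_le.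
Qed.

Lemma ln_step_lb (t : R) : 0 < t -> / (t + 1) <= ln (t + 1) - ln t.
Proof.
  intros Ht.
  assert (Hq : 0 < t / (t + 1)) by (apply Rdiv_lt_0_compat; lra).
  assert (H := exp_ineq1_le (- / (t + 1))).
  replace (1 + - / (t + 1)) with (t / (t + 1)) in H by (field; lra).
  apply ln_le in H; [|auto]. rewrite ln_exp, ln_div in H by lra. lra.
Qed.

Lemma INR_S_pos (k : nat) : 0 < INR (S k).
Proof. apply lt_0_INR; lia. Qed.

(** * Upper bound for the Laplace transform *)

(** The weight at time k + 1 raises the coefficient to b'; averaging over the step then adds b' to G
    and applies the Riccati map. *)
Lemma W_step_le (lam G b x : R) (m k : nat) :
  (forall y, W lam m (S k) y <= exp (- G - b * y ^ 2)) ->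
  let b' := b + lam / INR (S k) ^ 2 in
  W lam (S m) k x <= exp (- G - b' - (b' - 2 * b' ^ 2) * x ^ 2).
Proof.
  intros H b'. rewrite W_S.
  assert (Hy : forall y, exp (- (lam / INR (S k) ^ 2 * y ^ 2)) * W lam m (S k) y
                         <= exp (- G) * exp (- (b' * y ^ 2))).
  { intros y. rewrite <- exp_plus.
    replace (- G + - (b' * y ^ 2))
      with (- (lam / INR (S k) ^ 2 * y ^ 2) + (- G - b * y ^ 2))
      by (unfold b'; ring).
    rewrite exp_plus. apply Rmult_le_compat_l; [apply Rlt_le, exp_pos | apply H]. }
  assert (H1 := Hy (x + 1)). assert (H2 := Hy (x - 1)).
  assert (H3 := gauss_step_le b' x).
  apply (Rmult_le_compat_l (exp (- G))) in H3; [|apply Rlt_le, exp_pos].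
  rewrite <- exp_plus in H3.
  replace (- G + (- b' - (b' - 2 * b' ^ 2) * x ^ 2))
    with (- G - b' - (b' - 2 * b' ^ 2) * x ^ 2) in H3 by ring.
  lra.
Qed.

(* The slope [a (1/k - 1/n)] vanishes at the terminal time [n], where [W = 1],
   and still satisfies the Riccati inequality [b_k <= b' - 2 b'^2]. *)
Lemma W_upper (lam a : R) (n k0 : nat) :
  0 <= a -> 0 <= lam -> (1 <= k0)%nat ->
  (forall k, (k0 <= k)%nat ->
     a * (1 + / INR k) + 2 * (a + lam / INR (S k)) ^ 2 <= lam) ->
  forall m k x, (k0 <= k)%nat -> (k + m)%nat = n ->
  W lam m k x <=
  exp (- (a * (ln (INR (S n)) - ln (INR (S k)) - (1 - INR k / INR n)))
       - a * (/ INR k - / INR n) * x ^ 2).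
Proof.
  intros Ha Hl Hk0 Hric m; induction m as [|m IH]; intros k x Hk Hn.
  - rewrite Nat.add_0_r in Hn; subst k. rewrite W_0.
    assert (INR n <> 0) by (apply not_0_INR; lia).
    match goal with |- 1 <= exp ?e => replace e with 0 by (field; auto) end.
    rewrite exp_0; lra.
  - eapply Rle_trans.
    { apply W_step_le. intros y. apply IH; lia. }
    apply exp_le.
    assert (HK : 0 < INR k) by (apply lt_0_INR; lia).
    assert (HkS := INR_S_pos k).
    assert (Hnpos : 0 < INR n) by (apply lt_0_INR; lia).
    assert (Hkn : INR (S k) <= INR n) by (apply le_INR; lia).
    assert (Hlog := ln_step_ub (INR (S k)) HkS).
    rewrite <- S_INR in Hlog.
    specialize (Hric k Hk).
    assert (HSk : INR (S k) = INR k + 1) by apply S_INR.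
    set (q := / INR (S k)) in *.
    assert (Hq : 0 < q) by (apply Rinv_0_lt_compat; auto).
    assert (Hqn : / INR n <= q) by (apply Rinv_le_contravar; auto).
    assert (Hni : 0 < / INR n) by (apply Rinv_0_lt_compat; auto).
    (* The slope drops by a q^2 (1 + 1/k) per step, which is q^2 times the first term of [Hric]. *)
    assert (Hkq : / INR k - q = q ^ 2 * (1 + / INR k)).
    { unfold q. rewrite HSk. field. lra. }
    (* Each step adds at least a (1/(k+1) - 1/n) to the constant: the first part telescopes to
       logarithms, the second to 1 - k/n. *)
    assert (Hd : INR (S k) / INR n = INR k / INR n + / INR n).
    { rewrite HSk. field. lra. }
    unfold Rdiv in Hric. fold q in Hric.
    replace (lam / INR (S k) ^ 2) with (lam * q ^ 2)
      by (unfold q; field; lra).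
    set (b' := a * (q - / INR n) + lam * q ^ 2).
    assert (Hlq : 0 <= lam * q ^ 2) by (apply Rmult_le_pos; nra).
    assert (Hb0 : 0 <= a * (q - / INR n)) by (apply Rmult_le_pos; lra).
    assert (Hb1 : 0 <= b') by (unfold b'; lra).
    assert (Hb2 : b' <= q * (a + lam * q)).
    { unfold b'. assert (0 <= a * / INR n) by (apply Rmult_le_pos; lra). lra. }
    assert (Hb3 : b' ^ 2 <= q ^ 2 * (a + lam * q) ^ 2).
    { rewrite <- Rpow_mult_distr. apply pow_incr; auto. }
    assert (Hs : a * (/ INR k - / INR n) <= b' - 2 * b' ^ 2).
    { apply (Rmult_le_compat_l (q ^ 2)) in Hric; [|apply pow2_ge_0].
      replace (a * (/ INR k - / INR n)) with
        (q ^ 2 * (a * (1 + / INR k)) + a * (q - / INR n))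
        by (replace (/ INR k) with (q + (/ INR k - q)) at 2 by ring;
            rewrite Hkq; ring).
      unfold b' at 1. lra. }
    apply (Rmult_le_compat_r (x ^ 2)) in Hs; [|apply pow2_ge_0].
    rewrite Hd.
    assert (a * (ln (INR (S (S k))) - ln (INR (S k))) <= a * q)
      by (apply Rmult_le_compat_l; auto).
    unfold b' in *. lra.
Qed.

(** Earlier weights are at most 1, so a bound uniform in x travels back to time 0. This bridges the
    times below k0, where the Riccati inequality may fail. *)
Lemma W_prepend_le (lam B : R) (m k0 : nat) :
  0 <= lam -> (forall x, W lam m k0 x <= B) ->
  forall j k x, (k + j)%nat = k0 -> W lam (j + m) k x <= B.
Proof.
  intros Hl HB j; induction j as [|j IH]; intros k x Hk.
  - rewrite Nat.add_0_r in Hk; subst; apply HB.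
  - simpl Nat.add. rewrite W_S.
    assert (Hy : forall y,
      exp (- (lam / INR (S k) ^ 2 * y ^ 2)) * W lam (j + m) (S k) y <= B).
    { intros y. apply Rle_trans with (1 * W lam (j + m) (S k) y).
      - apply Rmult_le_compat_r; [apply W_nonneg|].
        apply exp_opp_le_1, Rmult_le_pos; [|apply pow2_ge_0].
        apply Rdiv_le_0_compat; [auto | apply pow_lt, INR_S_pos].
      - rewrite Rmult_1_l. apply IH; lia. }
    assert (H1 := Hy (x + 1)). assert (H2 := Hy (x - 1)). lra.
Qed.

Lemma INR_eventually_ge (A : R) : exists N : nat, forall n, (N <= n)%nat -> A <= INR n.
Proof.
  destruct (INR_unbounded A) as [N HN].
  exists N; intros n Hn. apply le_INR in Hn. lra.
Qed.

Lemma laplace_upper (lam a : R) :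
  0 <= a -> a + 2 * a ^ 2 < lam ->
  exists C N, 0 < C /\ forall n, (N <= n)%nat ->
    W lam n 0 0 <= C * exp (- (a * ln (INR n))).
Proof.
  intros Ha Hl. assert (Hl0 : 0 < lam) by nra.
  (* With e = 1/k <= 1, the Riccati inequality exceeds its limit a + 2 a^2 <= lam by at most [A] e;
     the strict gap [d] absorbs this for large k. *)
  set (A := a + 4 * a * lam + 2 * lam ^ 2).
  set (d := lam - a - 2 * a ^ 2).
  assert (Hd : 0 < d) by (unfold d; lra).
  assert (HA : 0 < A) by (unfold A; nra).
  destruct (INR_eventually_ge (A / d)) as [N1 HN1].
  set (k0 := S N1).
  assert (Hric : forall k, (k0 <= k)%nat ->
     a * (1 + / INR k) + 2 * (a + lam / INR (S k)) ^ 2 <= lam).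
  { intros k Hk.
    assert (HK : 1 <= INR k) by (apply (le_INR 1); unfold k0 in Hk; lia).
    assert (HkA : A / d <= INR k) by (apply HN1; unfold k0 in Hk; lia).
    set (e := / INR k).
    assert (He0 : 0 < e) by (apply Rinv_0_lt_compat; lra).
    assert (He1 : e <= 1).
    { unfold e. rewrite <- Rinv_1. apply Rinv_le_contravar; lra. }
    assert (HeA : e * A <= d).
    { apply (Rmult_le_compat_r (d * e)) in HkA; [|nra].
      replace (A / d * (d * e)) with (e * A) in HkA by (field; lra).
      replace (INR k * (d * e)) with d in HkA by (unfold e; field; lra). auto. }
    assert (Hq : lam / INR (S k) <= lam * e).
    { apply Rmult_le_compat_l; [lra|]. apply Rinv_le_contravar; [lra|].
      rewrite S_INR; lra. }
    assert (Hq0 : 0 <= lam / INR (S k))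
      by (apply Rdiv_le_0_compat; [lra | apply INR_S_pos]).
    assert (Hsq : (a + lam / INR (S k)) ^ 2 <= (a + lam * e) ^ 2)
      by (apply pow_incr; lra).
    assert (lam ^ 2 * e ^ 2 <= lam ^ 2 * e) by (apply Rmult_le_compat_l; nra).
    unfold A, d in HeA. nra. }
  (* The constant absorbs ln(k0 + 1) and the correction 1 - k0/n <= 1. *)
  exists (exp (a * (ln (INR (S k0)) + 1))), k0. split; [apply exp_pos|].
  intros n Hn.
  assert (Hn0 : 0 < INR n) by (apply lt_0_INR; unfold k0 in Hn; lia).
  replace n with (k0 + (n - k0))%nat at 1 by lia.
  apply (W_prepend_le lam _ (n - k0) k0); [lra | | lia].
  intros x. eapply Rle_trans.
  { apply (W_upper lam a n k0 Ha (Rlt_le _ _ Hl0)); auto; unfold k0; lia. }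
  rewrite <- exp_plus. apply exp_le.
  assert (0 <= INR k0 / INR n) by (apply Rdiv_le_0_compat; [apply pos_INR | auto]).
  assert (/ INR n <= / INR k0).
  { apply Rinv_le_contravar; [apply lt_0_INR; unfold k0; lia | apply le_INR; auto]. }
  assert (0 <= a * (/ INR k0 - / INR n) * x ^ 2).
  { apply Rmult_le_pos; [|apply pow2_ge_0]. apply Rmult_le_pos; lra. }
  assert (ln (INR n) <= ln (INR (S n))) by (apply ln_le; [auto | apply le_INR; lia]).
  assert (0 <= a * (ln (INR (S n)) - ln (INR n))) by (apply Rmult_le_pos; lra).
  assert (0 <= a * (INR k0 / INR n)) by (apply Rmult_le_pos; lra).
  lra.
Qed.

(** * Lower bound for the Laplace transform *)

(** The symmetrised exponential supermartingale of the walk. It is at least exp(eta^2 k/2)/2 once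
    |x| > eta k, so it controls both tails at once. *)
Definition cosh_supermart (eta : R) (k : nat) (x : R) : R :=
  (exp (eta * x) + exp (- (eta * x))) / 2 * exp (- (eta ^ 2 / 2 * INR k)).

Lemma cosh_supermart_pos (eta : R) (k : nat) (x : R) : 0 < cosh_supermart eta k x.
Proof.
  unfold cosh_supermart. assert (H1 := exp_pos (eta * x)).
  assert (H2 := exp_pos (- (eta * x))).
  apply Rmult_lt_0_compat; [lra | apply exp_pos].
Qed.

(** The addition formula makes the average equal to the old value times cosh(eta) exp(-eta^2/2), and
    this factor is at most 1. *)
Lemma cosh_supermart_step (eta : R) (k : nat) (x : R) :
  (cosh_supermart eta (S k) (x + 1) + cosh_supermart eta (S k) (x - 1)) / 2
  <= cosh_supermart eta k x.
Proof.
  assert (H := cosh_le_gauss eta).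
  assert (HE := cosh_supermart_pos eta k x).
  assert (Heq : (cosh_supermart eta (S k) (x + 1) + cosh_supermart eta (S k) (x - 1)) / 2
    = cosh_supermart eta k x * ((exp eta + exp (- eta)) / 2 * exp (- (eta ^ 2 / 2)))).
  { unfold cosh_supermart. rewrite S_INR.
    replace (eta * (x + 1)) with (eta * x + eta) by ring.
    replace (eta * (x - 1)) with (eta * x + - eta) by ring.
    replace (- (eta * x + eta)) with (- (eta * x) + - eta) by ring.
    replace (- (eta * x + - eta)) with (- (eta * x) + eta) by ring.
    replace (- (eta ^ 2 / 2 * (INR k + 1)))
      with (- (eta ^ 2 / 2 * INR k) + - (eta ^ 2 / 2)) by ring.
    rewrite !exp_plus. field. }
  rewrite Heq.
  rewrite <- (Rmult_1_r (cosh_supermart eta k x)) at 2.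
  apply Rmult_le_compat_l; [lra|].
  assert (Hp := exp_pos (eta ^ 2 / 2)).
  rewrite (exp_Ropp (eta ^ 2 / 2)). apply (Rmult_le_reg_r (exp (eta ^ 2 / 2))); [auto|].
  rewrite Rmult_assoc, Rinv_l by lra. lra.
Qed.

(** The weight is at most 1 and the error term a supermartingale, so the error passes backward with
    its coefficient [E] unchanged. *)
Lemma W_step_ge (lam G b E eta rho x : R) (m k : nat) :
  0 <= lam -> 0 <= E -> 0 < rho ->
  (forall y, exp (- G - b * y ^ 2) - E * cosh_supermart eta (S k) y <= W lam m (S k) y) ->
  let b' := b + lam / INR (S k) ^ 2 in
  rho * (2 * b' ^ 2 * x ^ 2) <= 1 - rho ->
  exp (- G - b' - (b' - 2 * rho * b' ^ 2) * x ^ 2) - E * cosh_supermart eta k x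
  <= W lam (S m) k x.
Proof.
  intros Hl HE Hr H b' Hx. rewrite W_S.
  assert (Hy : forall y,
    exp (- G) * exp (- (b' * y ^ 2)) - E * cosh_supermart eta (S k) y <=
    exp (- (lam / INR (S k) ^ 2 * y ^ 2)) * W lam m (S k) y).
  { intros y.
    set (w := exp (- (lam / INR (S k) ^ 2 * y ^ 2))).
    assert (Hw0 : 0 < w) by apply exp_pos.
    assert (Hw1 : w <= 1).
    { apply exp_opp_le_1, Rmult_le_pos; [|apply pow2_ge_0].
      apply Rdiv_le_0_compat; [auto | apply pow_lt, INR_S_pos]. }
    assert (H1 := H y).
    apply (Rmult_le_compat_l w) in H1; [|lra].
    assert (HM := cosh_supermart_pos eta (S k) y).
    assert (0 <= (1 - w) * (E * cosh_supermart eta (S k) y))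
      by (apply Rmult_le_pos; [lra|]; apply Rmult_le_pos; lra).
    assert (Heq : exp (- G) * exp (- (b' * y ^ 2)) = w * exp (- G - b * y ^ 2)).
    { unfold w. rewrite <- !exp_plus. f_equal. unfold b'; ring. }
    lra. }
  assert (H1 := Hy (x + 1)). assert (H2 := Hy (x - 1)).
  assert (H3 := gauss_step_ge rho b' x Hr Hx).
  apply (Rmult_le_compat_l (exp (- G))) in H3; [|apply Rlt_le, exp_pos].
  rewrite <- exp_plus in H3.
  replace (- G + (- b' - (b' - 2 * rho * b' ^ 2) * x ^ 2))
    with (- G - b' - (b' - 2 * rho * b' ^ 2) * x ^ 2) in H3 by ring.
  assert (H4 := cosh_supermart_step eta k x).
  apply (Rmult_le_compat_l E) in H4; [|auto].
  lra.
Qed.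

(* The comparison [cosh y >= exp (rho y^2 / 2)] is only available for
   [|x| <= eta k]; outside, the subtracted supermartingale already exceeds
   the Gaussian term and the bound is trivial. *)
Lemma W_lower (lam a eta rho : R) (n k0 : nat) :
  0 <= a -> 0 <= lam -> 0 < eta -> 0 < rho -> (1 <= k0)%nat ->
  lam <= a + 2 * rho * a ^ 2 ->
  rho * (2 * (a + lam) ^ 2 * eta ^ 2) <= 1 - rho ->
  (forall k, (k0 <= k)%nat -> a * ln (INR k) <= eta ^ 2 / 2 * INR k) ->
  forall m k x, (k0 <= k)%nat -> (k + m)%nat = n ->
  exp (- (a * (ln (INR n) - ln (INR k)) + lam * (/ INR k - / INR n))
       - a / INR k * x ^ 2)
  - 2 * exp (- (a * ln (INR n))) * cosh_supermart eta k x
  <= W lam m k x.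
Proof.
  intros Ha Hl Heta Hr Hk0 Hlam Hreta Hlog m; induction m as [|m IH]; intros k x Hk Hn.
  - rewrite Nat.add_0_r in Hn; subst k. rewrite W_0.
    assert (HK : 0 < INR n) by (apply lt_0_INR; lia).
    assert (H1 := cosh_supermart_pos eta n x).
    assert (H2 := exp_pos (- (a * ln (INR n)))).
    assert (0 <= exp (- (a * ln (INR n))) * cosh_supermart eta n x)
      by (apply Rmult_le_pos; lra).
    enough (exp (- (a * (ln (INR n) - ln (INR n)) + lam * (/ INR n - / INR n))
       - a / INR n * x ^ 2) <= 1) by lra.
    rewrite <- exp_0. apply exp_le.
    assert (0 <= a / INR n * x ^ 2).
    { apply Rmult_le_pos; [|apply pow2_ge_0]. apply Rdiv_le_0_compat; auto. }
    lra.
  - assert (HK : 0 < INR k) by (apply lt_0_INR; lia).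
    assert (HkS := INR_S_pos k).
    assert (HSk : INR (S k) = INR k + 1) by apply S_INR.
    assert (Hkn : INR k <= INR n) by (apply le_INR; lia).
    assert (Hnk : / INR n <= / INR k) by (apply Rinv_le_contravar; auto).
    destruct (Rle_dec (Rabs x) (eta * INR k)) as [Hx|Hx].
    + set (b' := a / INR (S k) + lam / INR (S k) ^ 2).
      set (q := / INR (S k)).
      assert (Hq : 0 < q) by (apply Rinv_0_lt_compat; auto).
      assert (Hq1 : q <= 1).
      { unfold q. rewrite <- Rinv_1. apply Rinv_le_contravar; lra. }
      assert (Hbq : b' = a * q + lam * q ^ 2) by (unfold b', q; field; lra).
      assert (Hb0 : 0 <= b').
      { rewrite Hbq. assert (0 <= a * q) by (apply Rmult_le_pos; lra).
        assert (0 <= lam * q ^ 2) by (apply Rmult_le_pos; nra). lra. }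
      assert (Hb1 : b' <= (a + lam) * q).
      { rewrite Hbq. assert (lam * q ^ 2 <= lam * q); [|lra].
        apply Rmult_le_compat_l; nra. }
      assert (Hb2 : a * q <= b').
      { rewrite Hbq. assert (0 <= lam * q ^ 2) by (apply Rmult_le_pos; nra). lra. }
      (* Inside the window b' |x| <= (a + lam) q eta k <= (a + lam) eta, a bound independent of
         k. *)
      assert (Hbx : rho * (2 * b' ^ 2 * x ^ 2) <= 1 - rho).
      { assert (Hbx1 : b' * Rabs x <= (a + lam) * eta).
        { apply Rle_trans with ((a + lam) * q * (eta * INR k)).
          - apply Rmult_le_compat; auto. apply Rabs_pos.
          - replace ((a + lam) * q * (eta * INR k))
              with ((a + lam) * eta * (q * INR k)) by ring.
            rewrite <- (Rmult_1_r ((a + lam) * eta)) at 2.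
            apply Rmult_le_compat_l; [apply Rmult_le_pos; lra|].
            apply (Rmult_le_reg_l (INR (S k))); [auto|].
            unfold q. rewrite <- Rmult_assoc, Rinv_r by lra. lra. }
        assert (Hsq : (b' * Rabs x) ^ 2 <= ((a + lam) * eta) ^ 2).
        { apply pow_incr; split;
            [apply Rmult_le_pos; [auto | apply Rabs_pos] | exact Hbx1]. }
        rewrite !Rpow_mult_distr, pow2_abs in Hsq.
        apply Rle_trans with (rho * (2 * (a + lam) ^ 2 * eta ^ 2)); [|auto].
        apply Rmult_le_compat_l; lra. }
      eapply Rle_trans; [|eapply (W_step_ge lam _ (a / INR (S k)) _ eta rho x m k);
                           [lra | | lra | intros y; apply IH; lia | exact Hbx]].
      2:{ assert (H2 := exp_pos (- (a * ln (INR n)))). lra. }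
      apply Rplus_le_compat_r, exp_le. fold b'.
      assert (Hlg := ln_step_lb (INR k) HK). rewrite <- HSk in Hlg. fold q in Hlg.
      assert (Hkq : / INR k - q = q ^ 2 * (1 + / INR k)).
      { unfold q. rewrite HSk. field. lra. }
      assert (Hik : 0 < / INR k) by (apply Rinv_0_lt_compat; auto).
      assert (Hkq2 : q ^ 2 <= / INR k - q).
      { rewrite Hkq. assert (0 <= q ^ 2 * / INR k) by (apply Rmult_le_pos; nra). lra. }
      (* Reverse Riccati inequality: lam q^2 <= a q^2 + 2 rho (a q)^2, where q^2 <= 1/k - q and a q
         <= b'. *)
      assert (Hs : b' - 2 * rho * b' ^ 2 <= a / INR k).
      { assert (Hbb : (a * q) ^ 2 <= b' ^ 2).
        { apply pow_incr; split; [apply Rmult_le_pos; lra | auto]. }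
        assert (rho * (a * q) ^ 2 <= rho * b' ^ 2) by (apply Rmult_le_compat_l; lra).
        assert (a * q ^ 2 <= a * (/ INR k - q)) by (apply Rmult_le_compat_l; auto).
        assert (lam * q ^ 2 <= (a + 2 * rho * a ^ 2) * q ^ 2)
          by (apply Rmult_le_compat_r; [apply pow2_ge_0 | auto]).
        rewrite Hbq at 1. unfold Rdiv. nra. }
      apply (Rmult_le_compat_r (x ^ 2)) in Hs; [|apply pow2_ge_0].
      assert (a * q <= a * (ln (INR (S k)) - ln (INR k)))
        by (apply Rmult_le_compat_l; auto).
      (* Of the increment b' = a q + lam q^2, the first part is charged to the logarithm and the
         second to the telescoping term lam/k. *)
      assert (lam * q ^ 2 <= lam * (/ INR k - q)) by (apply Rmult_le_compat_l; auto).
      fold q. rewrite Hbq in *. lra.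
    + apply Rle_trans with 0; [|apply W_nonneg].
      apply Rnot_le_lt in Hx.
      assert (Hc : exp (eta * Rabs x) <= exp (eta * x) + exp (- (eta * x))).
      { assert (H1 := exp_pos (eta * x)). assert (H2 := exp_pos (- (eta * x))).
        unfold Rabs; destruct (Rcase_abs x);
          [replace (eta * - x) with (- (eta * x)) by ring|]; lra. }
      assert (HM : exp (eta ^ 2 / 2 * INR k) <= 2 * cosh_supermart eta k x).
      { unfold cosh_supermart.
        apply (Rmult_le_compat_r (exp (- (eta ^ 2 / 2 * INR k)))) in Hc;
          [|apply Rlt_le, exp_pos].
        eapply Rle_trans; [|eapply Rle_trans; [apply Hc | lra]].
        rewrite <- exp_plus. apply exp_le. nra. }
      (* The Gaussian term is at most (k/n)^a, and [Hlog] bounds k^a by exp(eta^2 k/2). *)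
      assert (Hu : exp (- (a * (ln (INR n) - ln (INR k)) + lam * (/ INR k - / INR n))
                        - a / INR k * x ^ 2)
                   <= exp (- (a * ln (INR n))) * exp (eta ^ 2 / 2 * INR k)).
      { rewrite <- exp_plus. apply exp_le.
        specialize (Hlog k Hk).
        assert (0 <= lam * (/ INR k - / INR n)) by (apply Rmult_le_pos; lra).
        assert (0 <= a / INR k * x ^ 2).
        { apply Rmult_le_pos; [|apply pow2_ge_0]. apply Rdiv_le_0_compat; auto. }
        lra. }
      apply (Rmult_le_compat_l (exp (- (a * ln (INR n))))) in HM;
        [|apply Rlt_le, exp_pos].
      lra.
Qed.

(** Keep only the path that always steps toward the origin: it stays in [-1, 1], and each step costs
    probability 1/2 and a weight of at least exp(-lam). The resulting constant does not depend on
    m. *)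
Lemma W_single_path (lam : R) (k : nat) : 0 <= lam ->
  exists C, 0 < C /\ forall m, exists x, Rabs x <= 1 /\
    C * W lam m k x <= W lam (k + m) 0 0.
Proof.
  intros Hl; induction k as [|k [C [HC IH]]].
  - exists 1; split; [lra|]. intros m; exists 0. rewrite Rabs_R0. simpl. lra.
  - exists (C * (exp (- lam) / 2)). split.
    { assert (H := exp_pos (- lam)). apply Rmult_lt_0_compat; lra. }
    intros m. destruct (IH (S m)) as [x [Hx HW]].
    assert (Hy : forall y, Rabs y <= 1 ->
      exp (- lam) * W lam m (S k) y <=
      exp (- (lam / INR (S k) ^ 2 * y ^ 2)) * W lam m (S k) y).
    { intros y Hy. apply Rmult_le_compat_r; [apply W_nonneg|].
      apply exp_le.
      assert (HkS : 1 <= INR (S k)) by (apply (le_INR 1); lia).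
      assert (Hi : 0 < / INR (S k) ^ 2) by (apply Rinv_0_lt_compat, pow_lt; lra).
      assert (Hi1 : / INR (S k) ^ 2 <= 1).
      { rewrite <- Rinv_1. apply Rinv_le_contravar; [lra|]. nra. }
      assert (Hy2 : y ^ 2 <= 1).
      { rewrite <- pow2_abs. assert (H := Rabs_pos y). nra. }
      assert (/ INR (S k) ^ 2 * y ^ 2 <= 1)
        by (assert (H := pow2_ge_0 y); nra).
      unfold Rdiv. rewrite Rmult_assoc. nra. }
    assert (Hp : forall y, 0 <= exp (- (lam / INR (S k) ^ 2 * y ^ 2)) * W lam m (S k) y).
    { intros y. apply Rmult_le_pos; [apply Rlt_le, exp_pos | apply W_nonneg]. }
    rewrite W_S in HW. rewrite Nat.add_succ_l, <- Nat.add_succ_r.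
    apply Rabs_le_between in Hx.
    assert (H1 := Hp (x + 1)). assert (H2 := Hp (x - 1)).
    destruct (Rle_dec 0 x).
    + exists (x - 1). assert (Hx1 : Rabs (x - 1) <= 1) by (apply Rabs_le; lra).
      split; [auto|]. specialize (Hy _ Hx1).
      eapply Rle_trans; [|exact HW].
      rewrite Rmult_assoc. apply Rmult_le_compat_l; lra.
    + exists (x + 1). assert (Hx1 : Rabs (x + 1) <= 1) by (apply Rabs_le; lra).
      split; [auto|]. specialize (Hy _ Hx1).
      eapply Rle_trans; [|exact HW].
      rewrite Rmult_assoc. apply Rmult_le_compat_l; lra.
Qed.

Lemma ln_sublinear (a s : R) : 0 < a -> 0 < s ->
  exists N, forall k, (N <= k)%nat -> a * ln (INR k) <= s * INR k.
Proof.
  (* By ln(t k) <= t k with this t, half of s k pays for a ln(t k); the other half absorbs -a ln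
     t. *)
  intros Ha Hs. set (t := s / (2 * a)).
  assert (Ht : 0 < t) by (apply Rdiv_lt_0_compat; lra).
  destruct (INR_eventually_ge (2 * a * (- ln t) / s)) as [N HN].
  exists (S N); intros k Hk.
  assert (HK : 0 < INR k) by (apply lt_0_INR; lia).
  assert (HNk : 2 * a * (- ln t) / s <= INR k) by (apply HN; lia).
  assert (Hln : ln (t * INR k) <= t * INR k).
  { rewrite <- (ln_exp (t * INR k)) at 2. apply ln_le.
    - apply Rmult_lt_0_compat; auto.
    - assert (H := exp_ineq1_le (t * INR k)). lra. }
  rewrite ln_mult in Hln by auto.
  apply (Rmult_le_compat_l (s / 2)) in HNk; [|lra].
  replace (s / 2 * (2 * a * - ln t / s)) with (a * - ln t) in HNk by (field; lra).
  apply (Rmult_le_compat_l a) in Hln; [|lra].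
  replace (a * (t * INR k)) with (s / 2 * INR k) in Hln by (unfold t; field; lra).
  lra.
Qed.

(** Parameters are fixed in order: the strict gap gives rho = 1 - t, then eta is small enough for
    the cosh comparison, then k0 is large. [W_single_path] covers the first k0 steps. *)
Lemma laplace_lower (lam a : R) :
  0 < lam -> 0 < a -> lam < a + 2 * a ^ 2 ->
  exists C N, 0 < C /\ forall n, (N <= n)%nat ->
    C * exp (- (a * ln (INR n))) <= W lam n 0 0.
Proof.
  intros Hl Ha Hla.
  set (t := Rmin (1 / 2) ((a + 2 * a ^ 2 - lam) / (2 * a ^ 2))).
  assert (Ht0 : 0 < t).
  { apply Rmin_glb_lt; [lra|]. apply Rdiv_lt_0_compat; nra. }
  assert (Ht1 : t <= 1 / 2) by apply Rmin_l.
  assert (Ht2 : 2 * a ^ 2 * t <= a + 2 * a ^ 2 - lam).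
  { assert (H : t <= (a + 2 * a ^ 2 - lam) / (2 * a ^ 2)) by apply Rmin_r.
    apply (Rmult_le_compat_l (2 * a ^ 2)) in H; [|nra].
    replace (2 * a ^ 2 * ((a + 2 * a ^ 2 - lam) / (2 * a ^ 2)))
      with (a + 2 * a ^ 2 - lam) in H by (field; lra). auto. }
  set (s := 2 * (a + lam) ^ 2).
  assert (Hs : 0 < s) by (unfold s; nra).
  set (eta := Rmin 1 (t / s)).
  assert (He0 : 0 < eta) by (apply Rmin_glb_lt; [lra | apply Rdiv_lt_0_compat; auto]).
  assert (He1 : eta <= 1) by apply Rmin_l.
  assert (He2 : s * eta <= t).
  { assert (H : eta <= t / s) by apply Rmin_r.
    apply (Rmult_le_compat_l s) in H; [|lra].
    replace (s * (t / s)) with t in H by (field; lra). auto. }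
  assert (He3 : (1 - t) * (2 * (a + lam) ^ 2 * eta ^ 2) <= 1 - (1 - t)).
  { fold s. assert (s * eta ^ 2 <= t).
    { apply Rle_trans with (s * eta); [apply Rmult_le_compat_l; nra | auto]. }
    assert (0 <= s * eta ^ 2) by (apply Rmult_le_pos; nra). nra. }
  destruct (ln_sublinear a (eta ^ 2 / 2) Ha) as [N1 HN1]; [nra|].
  destruct (INR_eventually_ge ((eta + lam + a + 2) / (eta ^ 2 / 2))) as [N2 HN2].
  set (k0 := S (N1 + N2)).
  assert (HK1 : 1 <= INR k0) by (apply (le_INR 1); unfold k0; lia).
  (* For |x| <= 1 this makes the supermartingale at most exp(-(lam+a)-2) <= exp(-(lam+a))/3;
     subtracting it twice leaves a third of the main term. *)
  assert (HK2 : eta + lam + a + 2 <= eta ^ 2 / 2 * INR k0).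
  { assert (H : (eta + lam + a + 2) / (eta ^ 2 / 2) <= INR k0)
      by (apply HN2; unfold k0; lia).
    apply (Rmult_le_compat_l (eta ^ 2 / 2)) in H; [|nra].
    replace (eta ^ 2 / 2 * ((eta + lam + a + 2) / (eta ^ 2 / 2)))
      with (eta + lam + a + 2) in H by (field; lra). auto. }
  destruct (W_single_path lam k0 (Rlt_le _ _ Hl)) as [C [HC Hpath]].
  exists (C * (exp (- (lam + a)) / 3)), k0. split.
  { assert (H := exp_pos (- (lam + a))). apply Rmult_lt_0_compat; lra. }
  intros n Hn.
  destruct (Hpath (n - k0)%nat) as [x [Hx HW]].
  replace (k0 + (n - k0))%nat with n in HW by lia.
  eapply Rle_trans; [|exact HW].
  rewrite Rmult_assoc. apply Rmult_le_compat_l; [lra|].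
  eapply Rle_trans; [|apply (W_lower lam a eta (1 - t) n k0); auto;
                        [| lra | lra | | lra | intros; apply HN1 |]]; try lra;
    try (unfold k0 in *; lia).
  assert (Hy2 : 0 <= x ^ 2 <= 1).
  { split; [apply pow2_ge_0|]. rewrite <- pow2_abs. assert (H := Rabs_pos x). nra. }
  assert (Hx' := Hx). apply Rabs_le_between in Hx'.
  set (z := exp (- (a * ln (INR n)))).
  assert (Hz : 0 < z) by apply exp_pos.
  assert (H1 : z * exp (- (lam + a)) <=
    exp (- (a * (ln (INR n) - ln (INR k0)) + lam * (/ INR k0 - / INR n))
         - a / INR k0 * x ^ 2)).
  { unfold z. rewrite <- exp_plus. apply exp_le.
    assert (0 <= ln (INR k0)) by (rewrite <- ln_1; apply ln_le; lra).
    assert (0 <= a * ln (INR k0)) by (apply Rmult_le_pos; lra).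
    assert (Hn0 : INR k0 <= INR n) by (apply le_INR; auto).
    assert (0 < / INR n) by (apply Rinv_0_lt_compat; lra).
    assert (0 < / INR k0) by (apply Rinv_0_lt_compat; lra).
    assert (Hk1 : / INR k0 <= 1).
    { rewrite <- Rinv_1. apply Rinv_le_contravar; lra. }
    assert (lam * (/ INR k0 - / INR n) <= lam * 1) by (apply Rmult_le_compat_l; lra).
    assert (/ INR k0 * x ^ 2 <= 1) by nra.
    assert (a * (/ INR k0 * x ^ 2) <= a * 1) by (apply Rmult_le_compat_l; lra).
    unfold Rdiv. lra. }
  assert (H2 : cosh_supermart eta k0 x <= exp (- (lam + a)) / 3).
  { unfold cosh_supermart.
    assert (Ha1 : exp (eta * x) <= exp eta) by (apply exp_le; nra).
    assert (Ha2 : exp (- (eta * x)) <= exp eta) by (apply exp_le; nra).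
    apply Rle_trans with (exp eta * exp (- (eta ^ 2 / 2 * INR k0))).
    { apply Rmult_le_compat_r; [apply Rlt_le, exp_pos | lra]. }
    rewrite <- exp_plus.
    apply Rle_trans with (exp (- (lam + a) + - (1 + 1))).
    { apply exp_le; lra. }
    rewrite exp_plus. apply Rmult_le_compat_l; [apply Rlt_le, exp_pos|].
    rewrite exp_Ropp. apply Rinv_le_contravar; [lra|].
    assert (H := exp_ineq1_le (1 + 1)). lra. }
  apply (Rmult_le_compat_l (2 * z)) in H2; [|lra].
  lra.
Qed.

(** * From Laplace transforms to probabilities *)

Lemma exp_mul_scal (C u v : R) : exp u * (C * exp v) = C * exp (u + v).
Proof. rewrite exp_plus. ring. Qed.

Lemma probL_Ex (c : R) (n : nat) :
  probL c n =
  Ex n (fun xs => if Rle_dec (Lfrom 0 0 xs) (c * ln (INR n)) then 1 else 0).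
Proof.
  unfold probL. rewrite Ex_indicator. apply Ex_ext; intros xs _.
  rewrite Ln_Lfrom. now destruct (Rle_dec _ _).
Qed.

(** Exponential Markov inequality: exp(lam (c ln n - L)) >= 1 on the event. *)
Lemma probL_chernoff (lam c : R) (n : nat) :
  0 <= lam -> probL c n <= exp (lam * (c * ln (INR n))) * W lam n 0 0.
Proof.
  intros Hl. rewrite probL_Ex. unfold W. rewrite <- Ex_scal.
  apply Ex_le; intros xs _. rewrite <- exp_plus.
  destruct (Rle_dec _ _) as [H|H]; [|apply Rlt_le, exp_pos].
  rewrite <- exp_0 at 1. apply exp_le.
  apply (Rmult_le_compat_l lam) in H; lra.
Qed.

(* The tilted measure [exp (- lam0 L)] gives little mass to [L > u] (compare
   with [lam1]) and to [L < v] (compare with [lam2]); on [v <= L <= u] its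
   density is at most [exp (- lam0 v)]. *)
Lemma probL_tilt_lower (lam0 lam1 lam2 c c2 : R) (n : nat) :
  0 <= lam0 -> lam1 <= lam0 -> lam0 <= lam2 ->
  let T := ln (INR n) in
  exp (lam0 * (c2 * T)) *
  (W lam0 n 0 0 - exp (- ((lam0 - lam1) * (c * T))) * W lam1 n 0 0
   - exp ((lam2 - lam0) * (c2 * T)) * W lam2 n 0 0)
  <= probL c n.
Proof.
  intros H0 H1 H2 T. rewrite probL_Ex. fold T.
  set (u := c * T). set (v := c2 * T).
  enough (H : W lam0 n 0 0 <=
     exp (- (lam0 * v)) *
       Ex n (fun xs => if Rle_dec (Lfrom 0 0 xs) u then 1 else 0)
     + exp (- ((lam0 - lam1) * u)) * W lam1 n 0 0
     + exp ((lam2 - lam0) * v) * W lam2 n 0 0).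
  { assert (Hp := exp_pos (lam0 * v)).
    rewrite exp_Ropp in H.
    apply (Rmult_le_reg_l (/ exp (lam0 * v))); [apply Rinv_0_lt_compat; auto|].
    rewrite <- Rmult_assoc, Rinv_l by lra. lra. }
  unfold W. rewrite <- !Ex_scal, <- !Ex_plus. apply Ex_le; intros xs _.
  set (L := Lfrom 0 0 xs).
  rewrite <- !exp_plus.
  assert (P1 := exp_pos (- ((lam0 - lam1) * u) + - (lam1 * L))).
  assert (P2 := exp_pos ((lam2 - lam0) * v + - (lam2 * L))).
  assert (P3 := exp_pos (- (lam0 * v))).
  destruct (Rle_dec L u) as [Hu|Hu].
  - destruct (Rle_dec v L) as [Hv|Hv].
    + assert (exp (- (lam0 * L)) <= exp (- (lam0 * v))) by (apply exp_le; nra). lra.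
    + assert (exp (- (lam0 * L)) <= exp ((lam2 - lam0) * v + - (lam2 * L)))
        by (apply exp_le; nra). lra.
  - assert (exp (- (lam0 * L)) <= exp (- ((lam0 - lam1) * u) + - (lam1 * L)))
      by (apply exp_le; nra). lra.
Qed.

Lemma ln_INR_eventually_ge (A : R) :
  exists N, forall n, (N <= n)%nat -> A <= ln (INR n).
Proof.
  destruct (INR_eventually_ge (exp A)) as [N HN]. exists N; intros n Hn.
  rewrite <- (ln_exp A). apply ln_le; [apply exp_pos | now apply HN].
Qed.

Lemma exp_decay_eventually (C d e : R) :
  0 < d -> 0 < e ->
  exists N, forall n, (N <= n)%nat -> C * exp (- (d * ln (INR n))) <= e.
Proof.
  intros Hd He. destruct (Rle_dec C 0) as [HC|HC].
  - exists 0%nat; intros n _. assert (H := exp_pos (- (d * ln (INR n)))). nra.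
  - apply Rnot_le_lt in HC.
    destruct (ln_INR_eventually_ge (ln (C / e) / d)) as [N HN].
    exists N; intros n Hn. specialize (HN n Hn).
    assert (Hq : 0 < C / e) by (apply Rdiv_lt_0_compat; auto).
    apply (Rmult_le_compat_l d) in HN; [|lra].
    replace (d * (ln (C / e) / d)) with (ln (C / e)) in HN by (field; lra).
    assert (H : exp (- (d * ln (INR n))) <= exp (- ln (C / e))) by (apply exp_le; lra).
    rewrite (exp_Ropp (ln (C / e))), exp_ln in H by auto.
    apply (Rmult_le_compat_l C) in H; [|lra].
    replace (C * / (C / e)) with e in H by (field; lra). auto.
Qed.

(** * Optimal exponent and the two bounds for the probability *)

(** The maximiser of a - (a + 2 a^2) c, that is, the solution of (1 + 4 a) c = 1. *)
Definition rate_opt (c : R) : R := (/ c - 1) / 4.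

Lemma rate_opt_pos (c : R) : 0 < c -> c < 1 -> 0 < rate_opt c.
Proof.
  intros H0 H1. unfold rate_opt.
  assert (/ 1 < / c) by (apply Rinv_lt_contravar; lra).
  rewrite Rinv_1 in *. lra.
Qed.

(** Identifies K(c) with the Chernoff exponent a - lam c at the optimal a, where lam = a + 2 a^2. *)
Lemma Kc_legendre (c : R) : c <> 0 ->
  Kc c = rate_opt c - (rate_opt c + 2 * rate_opt c ^ 2) * c.
Proof. intros H. unfold Kc, rate_opt. field. auto. Qed.

Lemma probL_upper (c eps : R) : 0 < c -> c < 1 -> 0 < eps ->
  exists C N, 0 < C /\ forall n, (N <= n)%nat ->
    probL c n <= C * exp (- ((Kc c - eps) * ln (INR n))).
Proof.
  intros H0 H1 He.
  assert (Ha := rate_opt_pos c H0 H1). set (a := rate_opt c) in *.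
  (* [laplace_upper] needs a strict inequality; lowering the rate by at most eps provides it and
     keeps the rate nonnegative. *)
  set (a1 := a - Rmin eps a).
  assert (Hm : 0 < Rmin eps a) by (apply Rmin_glb_lt; auto).
  assert (Hm1 := Rmin_l eps a). assert (Hm2 := Rmin_r eps a).
  destruct (laplace_upper (a + 2 * a ^ 2) a1) as [C [N [HC HN]]];
    [unfold a1; lra | unfold a1; nra |].
  exists C, (S N). split; [auto|]. intros n Hn.
  eapply Rle_trans; [apply (probL_chernoff (a + 2 * a ^ 2)); nra|].
  specialize (HN n ltac:(lia)).
  apply (Rmult_le_compat_l (exp ((a + 2 * a ^ 2) * (c * ln (INR n))))) in HN;
    [|apply Rlt_le, exp_pos].
  eapply Rle_trans; [exact HN|].
  rewrite exp_mul_scal.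
  apply Rmult_le_compat_l; [lra|]. apply exp_le.
  rewrite Kc_legendre by lra. fold a.
  assert (HT : 0 <= ln (INR n)).
  { rewrite <- ln_1. apply ln_le; [lra|]. apply (le_INR 1); lia. }
  assert (Rmin eps a * ln (INR n) <= eps * ln (INR n))
    by (apply Rmult_le_compat_r; auto).
  unfold a1. lra.
Qed.

(** Tilting at a0 = a + th, slightly beyond the optimum, makes L / ln n concentrate near 1/(1 + 4
    a0) = c/(1 + 4 c th), strictly between c2 and c. Both tails outside [c2, c] are then
    negligible. *)
Lemma probL_lower (c eps : R) : 0 < c -> c < 1 -> 0 < eps ->
  exists C N, 0 < C /\ forall n, (N <= n)%nat ->
    C * exp (- ((Kc c + eps) * ln (INR n))) <= probL c n.
Proof.
  intros H0 H1 He.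
  assert (Ha := rate_opt_pos c H0 H1). set (a := rate_opt c) in *.
  set (th := Rmin (Rmin 1 a) (eps / 3)).
  assert (Hth0 : 0 < th) by (repeat apply Rmin_glb_lt; lra).
  assert (Hth : th <= Rmin 1 a) by apply Rmin_l.
  assert (Hth1 : th <= 1) by (eapply Rle_trans; [exact Hth | apply Rmin_l]).
  assert (Hth2 : th <= a) by (eapply Rle_trans; [exact Hth | apply Rmin_r]).
  assert (Hth3 : th <= eps / 3) by apply Rmin_r.
  clearbody th. clear Hth.
  set (lam := fun s : R => s + 2 * s ^ 2).
  set (a0 := a + th).
  (* The secant slope of [lam] from a0 to a0 + th is (1 + 6 c th)/c; taking 7 > 6 makes its product
     with c2 less than 1. *)
  set (c2 := c / (1 + 7 * c * th)).
  set (tau := c * th ^ 2 / 32).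
  assert (Hcth : 0 < c * th) by (apply Rmult_lt_0_compat; auto).
  assert (Hct : c * th <= 1) by nra.
  assert (Htau0 : 0 < tau) by (unfold tau; nra).
  assert (Htau1 : tau <= th / 32) by (unfold tau; nra).
  assert (Hac : (1 + 4 * a) * c = 1) by (unfold a, rate_opt; field; lra).
  assert (Hc2 : c2 * (1 + 7 * c * th) = c) by (unfold c2; field; lra).
  assert (Hc20 : 0 < c2) by (apply Rdiv_lt_0_compat; lra).
  assert (Hc21 : c - 7 * c ^ 2 * th <= c2).
  { apply (Rmult_le_reg_r (1 + 7 * c * th)); [lra|]. rewrite Hc2.
    replace ((c - 7 * c ^ 2 * th) * (1 + 7 * c * th))
      with (c - 49 * c * (c * th) ^ 2) by ring.
    assert (0 <= c * (c * th) ^ 2) by (apply Rmult_le_pos; [lra | apply pow2_ge_0]).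
    lra. }
  (* The comparison tilts have rates [a = a0 - th] and [a0 + th]; the slack in
     both exponents is quadratic in [th], which dictates [tau]. *)
  assert (E1 : (lam a0 - lam a) * c = th + 2 * c * th ^ 2).
  { unfold lam, a0.
    replace ((a + th + 2 * (a + th) ^ 2 - (a + 2 * a ^ 2)) * c)
      with (th * ((1 + 4 * a) * c) + 2 * c * th ^ 2) by ring.
    rewrite Hac; ring. }
  assert (E2 : (lam (a0 + th) - lam a0) * c2 <= th - 3 * tau).
  { apply (Rmult_le_reg_r (1 + 7 * c * th)); [lra|].
    rewrite Rmult_assoc, Hc2.
    replace ((lam (a0 + th) - lam a0) * c) with
      (th * ((1 + 4 * a) * c) + 6 * c * th ^ 2) by (unfold lam, a0; ring).
    rewrite Hac.
    assert (3 * tau * (1 + 7 * c * th) <= 3 * tau * 8) by (apply Rmult_le_compat_l; lra).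
    unfold tau in *. nra. }
  (* Loss budget: th from a0, at most th/32 from tau, and 7 th/8 from replacing c by c2, since
     lam(a) c^2 = (1 - c^2)/8. The total is below 3 th <= eps. *)
  assert (E0 : - (Kc c + eps) <= lam a0 * c2 - (a0 + tau)).
  { rewrite Kc_legendre by lra. fold a. change (a + 2 * a ^ 2) with (lam a).
    assert (Hl : lam a <= lam a0) by (unfold lam, a0; nra).
    assert (Hl0 : 0 < lam a) by (unfold lam; nra).
    assert (Hl2 : lam a * c ^ 2 <= 1 / 8).
    { replace (lam a * c ^ 2) with
        ((((1 + 4 * a) * c) ^ 2 - c ^ 2) / 8) by (unfold lam; field).
      rewrite Hac. nra. }
    assert (lam a * c2 <= lam a0 * c2) by (apply Rmult_le_compat_r; lra).
    assert (lam a * (c - 7 * c ^ 2 * th) <= lam a * c2)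
      by (apply Rmult_le_compat_l; lra).
    assert (lam a * c ^ 2 * th <= 1 / 8 * th) by (apply Rmult_le_compat_r; lra).
    assert (Ha0 : a0 = a + th) by reflexivity. lra. }
  (* Shifting each rate by tau gives the strict inequalities required. Of a slack of 3 tau, two
     parts pay for the shifts in the main and comparison terms; the third gives the decay exp(-tau
     T). *)
  destruct (laplace_lower (lam a0) (a0 + tau)) as [C0 [N0 [HC0 HN0]]];
    [unfold lam, a0; nra | unfold a0; lra | unfold lam, a0; nra |].
  destruct (laplace_upper (lam a) (a - tau)) as [C1 [N1 [HC1 HN1]]];
    [lra | unfold lam; nra |].
  destruct (laplace_upper (lam (a0 + th)) (a0 + th - tau)) as [C2 [N2 [HC2 HN2]]];
    [unfold a0; lra | unfold lam, a0; nra |].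
  (* Both tails together are eventually at most half of the main term. *)
  destruct (exp_decay_eventually (C1 + C2) tau (C0 / 2) Htau0) as [N3 HN3]; [lra|].
  exists (C0 / 2), (S (N0 + N1 + N2 + N3)). split; [lra|].
  intros n Hn.
  specialize (HN0 n ltac:(lia)). specialize (HN1 n ltac:(lia)).
  specialize (HN2 n ltac:(lia)). specialize (HN3 n ltac:(lia)).
  assert (HT : 0 <= ln (INR n)).
  { rewrite <- ln_1. apply ln_le; [lra|]. apply (le_INR 1); lia. }
  eapply Rle_trans; [|apply (probL_tilt_lower (lam a0) (lam a) (lam (a0 + th)) c c2 n);
                       unfold lam, a0; nra].
  set (T := ln (INR n)) in *.
  set (z := exp (- ((a0 + tau) * T))) in *.
  assert (Hz : 0 < z) by apply exp_pos.
  assert (B1 : exp (- ((lam a0 - lam a) * (c * T))) * W (lam a) n 0 0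
               <= z * (C1 * exp (- (tau * T)))).
  { apply (Rmult_le_compat_l (exp (- ((lam a0 - lam a) * (c * T))))) in HN1;
      [|apply Rlt_le, exp_pos].
    eapply Rle_trans; [exact HN1|].
    unfold z. rewrite !exp_mul_scal.
    apply Rmult_le_compat_l; [lra|]. apply exp_le.
    rewrite <- (Rmult_assoc _ c T), E1.
    assert (0 <= (2 * c * th ^ 2 - 3 * tau) * T)
      by (apply Rmult_le_pos; [unfold tau; nra | auto]).
    unfold a0. lra. }
  assert (B2 : exp ((lam (a0 + th) - lam a0) * (c2 * T)) * W (lam (a0 + th)) n 0 0
               <= z * (C2 * exp (- (tau * T)))).
  { apply (Rmult_le_compat_l (exp ((lam (a0 + th) - lam a0) * (c2 * T)))) in HN2;
      [|apply Rlt_le, exp_pos].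
    eapply Rle_trans; [exact HN2|].
    unfold z. rewrite !exp_mul_scal.
    apply Rmult_le_compat_l; [lra|]. apply exp_le.
    rewrite <- (Rmult_assoc _ c2 T).
    apply (Rmult_le_compat_r T) in E2; [|auto]. lra. }
  apply (Rmult_le_compat_l z) in HN3; [|lra].
  assert (B3 : C0 / 2 * z <= W (lam a0) n 0 0
     - exp (- ((lam a0 - lam a) * (c * T))) * W (lam a) n 0 0
     - exp ((lam (a0 + th) - lam a0) * (c2 * T)) * W (lam (a0 + th)) n 0 0) by lra.
  apply (Rmult_le_compat_l (exp (lam a0 * (c2 * T)))) in B3; [|apply Rlt_le, exp_pos].
  eapply Rle_trans; [|exact B3].
  unfold z. rewrite exp_mul_scal.
  apply Rmult_le_compat_l; [lra|]. apply exp_le.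
  apply (Rmult_le_compat_r T) in E0; [|auto]. lra.
Qed.

(* Pr[L_n <= c ln n] = exp(-(K(c)+o(1)) ln n): eventually positive, and
   ln Pr / ln n -> -K(c). *)
Theorem theorem1p1 (c : R) (hc0 : 0 < c) (hc1 : c < 1) :
  forall eps : R, 0 < eps ->
  exists N : nat, forall n : nat, (N <= n)%nat ->
    0 < probL c n /\ Rabs (ln (probL c n) / ln (INR n) + Kc c) < eps.
Proof.
  intros eps He.
  destruct (probL_upper c (eps / 2) hc0 hc1) as [C1 [N1 [HC1 HN1]]]; [lra|].
  destruct (probL_lower c (eps / 2) hc0 hc1) as [C2 [N2 [HC2 HN2]]]; [lra|].
  (* Beyond this threshold ln n >= 1 and the constants contribute less than eps/2 after division by
     ln n; the other eps/2 is the loss in the exponents. *)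
  destruct (ln_INR_eventually_ge (1 + 2 * (Rabs (ln C1) + Rabs (ln C2)) / eps))
    as [N3 HN3].
  exists (N1 + N2 + N3)%nat; intros n Hn.
  specialize (HN1 n ltac:(lia)). specialize (HN2 n ltac:(lia)).
  specialize (HN3 n ltac:(lia)).
  set (T := ln (INR n)) in *. set (p := probL c n) in *.
  assert (Hp : 0 < p).
  { eapply Rlt_le_trans; [|exact HN2].
    apply Rmult_lt_0_compat; [auto | apply exp_pos]. }
  split; [auto|].
  assert (A1 := Rabs_pos (ln C1)). assert (A2 := Rabs_pos (ln C2)).
  assert (A3 : ln C1 <= Rabs (ln C1)) by apply Rle_abs.
  assert (A4 : - ln C2 <= Rabs (ln C2)) by (rewrite <- Rabs_Ropp; apply Rle_abs).
  assert (HT : 1 <= T).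
  { assert (0 <= 2 * (Rabs (ln C1) + Rabs (ln C2)) / eps)
      by (apply Rdiv_le_0_compat; lra). lra. }
  assert (HTe : Rabs (ln C1) + Rabs (ln C2) < eps / 2 * T).
  { apply (Rmult_le_compat_l (eps / 2)) in HN3; [|lra].
    replace (eps / 2 * (1 + 2 * (Rabs (ln C1) + Rabs (ln C2)) / eps))
      with (eps / 2 + (Rabs (ln C1) + Rabs (ln C2))) in HN3 by (field; lra).
    lra. }
  apply ln_le in HN1; [|auto].
  apply ln_le in HN2; [|apply Rmult_lt_0_compat; [auto | apply exp_pos]].
  rewrite ln_mult, ln_exp in HN1, HN2 by (auto; apply exp_pos).
  replace (ln p / T + Kc c) with ((ln p + Kc c * T) / T) by (field; lra).
  apply Rabs_def1; apply (Rmult_lt_reg_r T); try lra;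
    unfold Rdiv; rewrite Rmult_assoc, Rinv_l by lra; lra.
Qed.
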